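(* Let $k \ge 3$ and let $\phi$ be an instance of Exact-one-in-$k$-SAT with variables $x_1,\dots,x_n$ and clauses $C_1,\dots,C_m$. Consider the system of inner-product constraints on vectors described below. (i) If $\phi$ has a satisfying assignment, then there is a family of vectors in $\mathbb{R}^{2k}$ satisfying all the constraints exactly. (ii) Conversely, if $r \le 4k-1$, $\epsilon < 10^{-6}k^{-5}$, and there is a family of vectors in $\mathbb{R}^r$ satisfying every constraint up to an additive error of $\pm\epsilon$, then $\phi$ has a satisfying assignment.
   Context: Exact-one-in-$k$-SAT: each clause $C$ consists of $k$ variables $x_{i_1},\dots,x_{i_k}$ together with signs $s_1,\dots,s_k \in \{+1,-1\}$; an assignment $f:\{x_1,\dots,x_n\} \to \{+1,-1\}$ satisfies $C$ iff exactly one $g \in [k]$ has $s_g f(x_{i_g}) = -1$ (equivalently $\sum_{g=1}^k s_g f(x_{i_g}) = k-2$); $\phi$ is satisfiable iff some assignment satisfies all clauses. The constraint system: let $x_0$ be an extra reference variable and $C_0$ an extra reference clause. Let $I = [2k] \cup \left(\binom{[2k]}{2} \times \{\pm 1\}\right)$, where $\binom{[2k]}{2}$ is the set of pairs $(i,j)$ with $1 \le i < j \le 2k$. For every $x \in \{x_0,\dots,x_n\}$ there are vectors $u_{(x,s)}$, $s \in I$ (written $u_{(x,i)}$ for $i \in [2k]$ and $u_{(x,i,j,\pm 1)}$ for the others), and for every $C \in \{C_0,\dots,C_m\}$ a vector $u_C$. Let $p:[2k]\to[2k]$ be $p(i) = i+1$ for odd $i$ and $p(i) = i-1$ for even $i$.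 Internal variable constraints (for every $x \in \{x_0,\dots,x_n\}$): $u_{(x,s)} \cdot u_{(x,s)} = 1$ for all $s \in I$; $u_{(x,i)} \cdot u_{(x,j)} = \delta_{ij}$ for $i,j \in [2k]$; $u_{(x,i,j,+1)} \cdot u_{(x,i)} = u_{(x,i,j,+1)} \cdot u_{(x,j)} = \frac{1}{\sqrt{2}}$ and $u_{(x,i,j,-1)} \cdot u_{(x,i)} = -u_{(x,i,j,-1)} \cdot u_{(x,j)} = \frac{1}{\sqrt{2}}$ for $(i,j) \in \binom{[2k]}{2}$. External variable constraints (for every $x \in \{x_1,\dots,x_n\}$): $u_{(x_0,i)} \cdot u_{(x,j)} = 0$ for $i,j \in [2k]$ with $j \ne p(i)$; $u_{(x_0,i,p(i),+1)} \cdot u_{(x,i,p(i),+1)} = 0$ for odd $i \in [2k]$; $u_{(x_0,i,j,+1)} \cdot u_{(x,p(i),p(j),-1)} = 0$ for $(i,j) \in \binom{[2k]}{2}$ with $i,j$ both odd. Internal clause constraints: $u_{C_0} \cdot u_{C_0} = 1$; $u_{C_0} \cdot u_{(x_0,2g-1)} = \frac{1}{\sqrt{k}}$ for every $g \in [k]$; and for every clause $C \in \{C_1,\dots,C_m\}$ with variables $x_{i_1},\dots,x_{i_k}$ and signs $s_1,\dots,s_k$: $u_C \cdot u_C = 1$ and $u_C \cdot u_{(x_{i_g},2g)} = \frac{s_g}{\sqrt{k}}$ for every $g \in [k]$. External clause constraints: $u_{C_0} \cdot u_C = 1 - 2/k$ for every $C \in \{C_1,\dots,C_m\}$. *)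

(* Defs.v *)
From HB Require Import structures.
From mathcomp Require Import all_boot all_order all_algebra.
From mathcomp Require Import reals.
Set Implicit Arguments. Unset Strict Implicit. Unset Printing Implicit Defensive.
Import Order.TTheory GRing.Theory Num.Theory.
Local Open Scope ring_scope.

(* Variables x_1..x_n are encoded as 'I_n (x_{j+1} <-> j), clauses C_1..C_m as
   'I_m, positions 1..k in a clause as 'I_k.  A clause c has variables
   vars c g and signs sgn_of (sg c g), where the boolean true encodes +1 and
   false encodes -1.  Assignments map variables to {+1,-1} (again via bool). *)
Definition sgn_of (b : bool) : int := if b then 1 else -1.

Definition clause_sat (n k : nat) (f : 'I_n -> bool)
    (v : 'I_k -> 'I_n) (s : 'I_k -> bool) : bool :=
  #|[set g : 'I_k | sgn_of (s g) * sgn_of (f (v g)) == -1]| == 1%N.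

Definition satisfiable (n m k : nat) (vars : 'I_m -> 'I_k -> 'I_n)
    (sg : 'I_m -> 'I_k -> bool) : Prop :=
  exists f : 'I_n -> bool, forall c : 'I_m, clause_sat f (vars c) (sg c).

Definition dotv (R : ringType) (r : nat) (u v : 'rV[R]_r) : R :=
  \sum_(i < r) u 0 i * v 0 i.

Definition pp (i : nat) : nat := if odd i then i.+1 else i.-1.

(* The family of vectors, with 1-indexed natural-number indices as in the paper:
     U x i       = u_(x_x, i)            x in 0..n, i in 1..2k
     W x i j s   = u_(x_x, i, j, s)      1 <= i < j <= 2k, s = true for +1, false for -1
     V c         = u_(C_c)               c in 0..m
   Values outside these ranges are irrelevant (never constrained).
   Each constraint "a = b" is imposed as  cmp a b;  cmp is equality for exact
   satisfaction and  |a - b| <= eps  for satisfaction up to additive error eps. *)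
Definition constraints (R : rcfType) (r n m k : nat)
    (vars : 'I_m -> 'I_k -> 'I_n) (sg : 'I_m -> 'I_k -> bool)
    (cmp : R -> R -> Prop)
    (U : nat -> nat -> 'rV[R]_r) (W : nat -> nat -> nat -> bool -> 'rV[R]_r)
    (V : nat -> 'rV[R]_r) : Prop :=
  let s2 := Num.sqrt (2%:R : R) in
  let sk := Num.sqrt (k%:R : R) in
  (forall x, (x <= n)%N ->
     (forall i, (1 <= i <= 2 * k)%N -> cmp (dotv (U x i) (U x i)) 1)
  /\ (forall i j s, (1 <= i)%N -> (i < j)%N -> (j <= 2 * k)%N ->
        cmp (dotv (W x i j s) (W x i j s)) 1)
  /\ (forall i j, (1 <= i <= 2 * k)%N -> (1 <= j <= 2 * k)%N ->
        cmp (dotv (U x i) (U x j)) (if i == j then 1 else 0))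
  /\ (forall i j, (1 <= i)%N -> (i < j)%N -> (j <= 2 * k)%N ->
        [/\ cmp (dotv (W x i j true) (U x i)) (1 / s2),
            cmp (dotv (W x i j true) (U x j)) (1 / s2),
            cmp (dotv (W x i j false) (U x i)) (1 / s2) &
            cmp (- dotv (W x i j false) (U x j)) (1 / s2)]))
  /\ (forall x, (1 <= x <= n)%N ->
     (forall i j, (1 <= i <= 2 * k)%N -> (1 <= j <= 2 * k)%N -> j != pp i ->
        cmp (dotv (U 0%N i) (U x j)) 0)
  /\ (forall i, (1 <= i <= 2 * k)%N -> odd i ->
        cmp (dotv (W 0%N i (pp i) true) (W x i (pp i) true)) 0)
  /\ (forall i j, (1 <= i)%N -> (i < j)%N -> (j <= 2 * k)%N -> odd i -> odd j ->
        cmp (dotv (W 0%N i j true) (W x (pp i) (pp j) false)) 0))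
  /\ cmp (dotv (V 0%N) (V 0%N)) 1
  /\ (forall g, (1 <= g <= k)%N -> cmp (dotv (V 0%N) (U 0%N (2 * g - 1)%N)) (1 / sk))
  /\ (forall c : 'I_m,
        cmp (dotv (V c.+1) (V c.+1)) 1
     /\ (forall g : 'I_k,
          cmp (dotv (V c.+1) (U (vars c g).+1 (2 * g.+1)%N))
              ((sgn_of (sg c g))%:~R / sk)))
  /\ (forall c : 'I_m, cmp (dotv (V 0%N) (V c.+1)) (1 - 2%:R / k%:R)).

Definition approx (R : realType) (eps : R) (a b : R) : Prop := `|a - b| <= eps.

(* Main.v *)
Require Import Defs.
From HB Require Import structures.
From mathcomp Require Import all_boot all_order all_algebra.
From mathcomp Require Import reals.
From mathcomp Require Import zify ring lra.
Import Order.TTheory GRing.Theory Num.Theory.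
Local Open Scope ring_scope.

(** Write [a_i] for the inner product of [u_(x0,i)] and [u_(x,p(i))].  The pair
    vectors [u_(x,i,j,+-1)] are forced to be close to
    [(u_(x,i) +- u_(x,j)) / sqrt 2], so the external variable constraints give
    [a_(i+1) = - a_i] and [a_i = a_j] for odd [i], [j], approximately.  All
    other inner products between the [2k] vectors of [x0] and the [2k] vectors
    of [x] are nearly 0, so in dimension less than [4k] some [|a_i|] must be
    nearly 1, for otherwise the [4k] vectors would have a strictly diagonally
    dominant Gram matrix.  Hence all [a_i] with [i] odd are close to a common sign
    [f x], that is, [u_(x,2g)] is close to [f x] times [u_(x0,2g-1)].  Then
    [u_C0 . u_C] is close to the average of the numbers [s_g f(x_(i_g))], and
    its value [1 - 2/k] leaves room for exactly one [-1].

    Errors are propagated through weighted AM-GM bounds on squared norms, which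
    avoids square roots of [eps]. *)

(** * Inner products: bilinearity, weighted AM-GM, and a diagonal dominance bound on the
    dimension *)

Section Dot.
Context {R : realFieldType} {r : nat}.
Implicit Types (a b : R) (u v w : 'rV[R]_r).

Lemma dotvC u v : dotv u v = dotv v u.
Proof. by apply: eq_bigr => i _; rewrite mulrC. Qed.

Lemma dotvDl u v w : dotv (u + v) w = dotv u w + dotv v w.
Proof. by rewrite -big_split; apply: eq_bigr => i _; rewrite mxE mulrDl. Qed.

Lemma dotvZl a u v : dotv (a *: u) v = a * dotv u v.
Proof. by rewrite /dotv mulr_sumr; apply: eq_bigr => i _; rewrite mxE mulrA. Qed.

Lemma dotvNl u v : dotv (- u) v = - dotv u v.
Proof. by rewrite -scaleN1r dotvZl mulN1r. Qed.

Lemma dot0v v : dotv 0 v = 0.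
Proof. by rewrite -(scale0r 0) dotvZl mul0r. Qed.

Lemma dotvDr u v w : dotv w (u + v) = dotv w u + dotv w v.
Proof. by rewrite dotvC dotvDl !(dotvC w). Qed.

Lemma dotvZr a u v : dotv u (a *: v) = a * dotv u v.
Proof. by rewrite dotvC dotvZl dotvC. Qed.

Lemma dotvNr u v : dotv u (- v) = - dotv u v.
Proof. by rewrite dotvC dotvNl dotvC. Qed.

Lemma dotv_suml (I : finType) (F : I -> 'rV[R]_r) v :
  dotv (\sum_i F i) v = \sum_i dotv (F i) v.
Proof.
by elim/big_rec2: _ => [|i y x _ <-]; [exact: dot0v | exact: dotvDl].
Qed.

Lemma dotv_sumr (I : finType) (F : I -> 'rV[R]_r) v :
  dotv v (\sum_i F i) = \sum_i dotv v (F i).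
Proof. by rewrite dotvC dotv_suml; apply: eq_bigr => i _; exact: dotvC. Qed.

Lemma dotv_ge0 u : 0 <= dotv u u.
Proof. by apply: sumr_ge0 => i _; rewrite -expr2 sqr_ge0. Qed.

Definition dotvE := (dotvDl, dotvDr, dotvNl, dotvNr, dotvZl, dotvZr).

(** Expand the nonnegative squared norms of [l *: u - v] and [l *: u + v] and divide by [l]. A large
    weight [l] suits a tiny [u] paired with a [v] of bounded norm. *)
Lemma dotv_amgm (l : R) u v : 0 < l ->
  `|dotv u v| <= (l * dotv u u + l^-1 * dotv v v) / 2.
Proof.
move=> l0; have ll : l * l^-1 = 1 by rewrite divff // gt_eqF.
have li : 0 < l^-1 by rewrite invr_gt0.
have h1 := mulr_ge0 (ltW li) (dotv_ge0 (l *: u - v)).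
have h2 := mulr_ge0 (ltW li) (dotv_ge0 (l *: u + v)).
have e1 : l^-1 * dotv (l *: u - v) (l *: u - v)
   = (l * l^-1) * (l * dotv u u - 2 * dotv u v) + l^-1 * dotv v v.
  by rewrite !dotvE (dotvC v u); ring.
have e2 : l^-1 * dotv (l *: u + v) (l *: u + v)
   = (l * l^-1) * (l * dotv u u + 2 * dotv u v) + l^-1 * dotv v v.
  by rewrite !dotvE (dotvC v u); ring.
rewrite e1 ll mul1r in h1; rewrite e2 ll mul1r in h2.
by rewrite ler_norml; apply/andP; split; lra.
Qed.

(** AM-GM with weight 1 on each of the [#|I| ^ 2] cross terms. *)
Lemma dotv_sum_sqr_le (I : finType) (F : I -> 'rV[R]_r) :
  dotv (\sum_i F i) (\sum_i F i) <= #|I|%:R * \sum_i dotv (F i) (F i).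
Proof.
have le2 : forall i j,
    dotv (F i) (F j) <= 2^-1 * dotv (F i) (F i) + 2^-1 * dotv (F j) (F j).
  move=> i j; apply: (le_trans (ler_norm _)).
  by apply: (le_trans (dotv_amgm 1 (F i) (F j) ltr01)); rewrite invr1; lra.
rewrite dotv_suml.
under eq_bigr do rewrite dotv_sumr.
apply: le_trans (ler_sum _ (fun i _ => ler_sum _ (fun j _ => le2 i j))) _.
under eq_bigr do rewrite big_split /= sumr_const -mulr_sumr.
rewrite big_split /= sumr_const sumrMnl -mulr_sumr -[_ *+ #|_|]mulr_natl.
by set S := \sum_i _; lra.
Qed.

(** In the double sum, [al] is paid only on the [k] diagonal terms and [be] on all [k ^ 2] of them.
    Keeping the two apart is what later makes [al] cost nothing in [k] after scaling by [1 / k]. *)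
Lemma dotv_sum_le (k : nat) (x y : 'I_k -> 'rV[R]_r) (a b : 'I_k -> R) (al be : R) :
  (forall i, `|a i| <= 1) -> (forall i, `|b i| <= 1) ->
  (forall i j, `|dotv (x i) (y j)| <= al *+ (i == j) + be) ->
  `|dotv (\sum_i a i *: x i) (\sum_i b i *: y i)| <= k%:R * al + k%:R ^+ 2 * be.
Proof.
move=> ha hb hxy; rewrite dotv_suml.
apply: le_trans (ler_norm_sum _ _ _) _.
have -> : k%:R * al + k%:R ^+ 2 * be = \sum_(i < k) (al + be *+ k).
  by rewrite sumr_const card_ord -mulr_natl -(mulr_natl be); ring.
apply: ler_sum => i _; rewrite dotv_sumr.
apply: le_trans (ler_norm_sum _ _ _) _.
have -> : al + be *+ k = \sum_(j < k) (al *+ (i == j) + be).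
  rewrite big_split /= sumr_const card_ord; congr (_ + _).
  by rewrite (bigD1 i) //= eqxx big1 ?addr0 // => j; rewrite eq_sym => /negPf ->.
apply: ler_sum => j _; rewrite dotvZl dotvZr !normrM.
apply: le_trans (hxy i j).
rewrite -[X in _ <= X]mul1r -[X in _ <= X]mul1r.
apply: ler_pM => //; first by rewrite mulr_ge0.
by apply: ler_wpM2r.
Qed.

(* Pairing a vanishing combination with the vector carrying its largest
   coefficient contradicts dominance. *)
Lemma card_diag_dominant (I : finType) (z : I -> 'rV[R]_r) :
  (forall i, \sum_(j | j != i) `|dotv (z j) (z i)| < dotv (z i) (z i)) ->
  (#|I| <= r)%N.
Proof.
move=> dom; rewrite leqNgt; apply/negP => ltr_I.
pose A : 'M[R]_(#|I|, r) := \matrix_(i < #|I|) z (enum_val i).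
have /rowV0Pn[w /sub_kermxP wA w0] : kermx A != 0.
  by rewrite -mxrank_eq0 mxrank_ker subn_eq0 -ltnNge (leq_ltn_trans (rank_leq_col A)).
pose c i := w 0 (enum_rank i).
have cz0 : \sum_i c i *: z i = 0.
  rewrite -[RHS]wA mulmx_sum_row (reindex enum_rank) /=; last first.
    by exists enum_val => i _; rewrite ?enum_rankK ?enum_valK.
  by apply: eq_bigr => i _; rewrite rowK enum_rankK.
have /existsP[i0 ci0] : [exists i, c i != 0].
  apply: contraNT w0 => /existsPn c0; apply/eqP/rowP => j; rewrite mxE.
  by have /negPn/eqP := c0 (enum_val j); rewrite /c enum_valK.
have [i _ imax] := @arg_maxP _ _ _ i0 xpredT (fun i => `|c i|) isT.
have ci : 0 < `|c i| by apply: lt_le_trans (imax i0 isT); rewrite normr_gt0.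
have := congr1 (fun u => dotv u (z i)) cz0; rewrite dot0v dotv_suml (bigD1 i) //= dotvZl.
move/eqP; rewrite addr_eq0 => /eqP /(congr1 Num.norm).
rewrite normrN normrM => eq_ci.
have := dom i; rewrite -(ltr_pM2l ci) -(ger0_norm (dotv_ge0 (z i))) eq_ci.
rewrite ltNge => /negP; apply; apply: le_trans (ler_norm_sum _ _ _) _.
rewrite mulr_sumr; apply: ler_sum => j _; rewrite dotvZl normrM.
by rewrite ler_wpM2r //; exact: imax.
Qed.

End Dot.

(** * From the variable constraints to a common sign for each variable *)

Section SignExtraction.
Context {R : realFieldType} {r : nat}.
Implicit Types (u v w x y z : 'rV[R]_r).

(* Forces w to be close to t (u + v) when t = 1 / sqrt 2. *)
Definition approx_mid (t eps : R) w u v : Prop :=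
  [/\ `|dotv u u - 1| <= eps, `|dotv v v - 1| <= eps, `|dotv u v| <= eps &
   [/\ `|dotv w w - 1| <= eps, `|dotv w u - t| <= eps & `|dotv w v - t| <= eps]].

(** The main terms of the expansion are [1 + 2 t^2 - 4 t^2 = 0]. The errors add up to [eps] from
    [w], [2 eps] from the squared norm of [t *: (u + v)], and [4 eps] from the mixed terms. *)
Lemma approx_mid_dist t eps w u v : 0 <= t -> t ^+ 2 = 1 / 2 -> approx_mid t eps w u v ->
  dotv (w - t *: (u + v)) (w - t *: (u + v)) <= 7 * eps.
Proof.
move=> t0 t2 [uu vv uv [ww wu wv]].
have eps0 : 0 <= eps by apply: le_trans uv.
have t1 : t <= 1 by rewrite -(ler_pXn2r (n := 2)) ?nnegrE // expr1n t2; lra.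
have -> : dotv (w - t *: (u + v)) (w - t *: (u + v)) = dotv w w
    + t ^+ 2 * (dotv u u + dotv v v + 2 * dotv u v) - 2 * (t * dotv w u + t * dotv w v).
  by rewrite !dotvE (dotvC v u) (dotvC u w) (dotvC v w); ring.
have tl z : `|dotv w z - t| <= eps -> t ^+ 2 - eps <= t * dotv w z.
  rewrite ler_norml => /andP[wz _].
  have te : t * eps <= eps by rewrite ler_piMl.
  by have := ler_wpM2l t0 wz; rewrite mulrBr -expr2; lra.
have := tl _ wu; have := tl _ wv; rewrite t2.
move: uu vv uv ww; rewrite !ler_norml => /andP[? ?] /andP[? ?] /andP[? ?] /andP[? ?] ? ?.
by lra.
Qed.

(** Replace [w] and [z] by the midpoints [A] and [B]. Each of the two replacement errors is at most
    [(7 l eps + 2 / l) / 2] by weighted AM-GM, and the outer factor 2 undoes [t ^+ 2]. The weight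
    [l] is chosen later. *)
Lemma approx_mid_dot t l eps w u v x y z : 0 <= t -> t ^+ 2 = 1 / 2 -> 0 < l -> eps <= 1 / 4 ->
  approx_mid t eps w u v -> approx_mid t eps z x y -> `|dotv w z| <= eps ->
  `|dotv (u + v) (x + y)| <= 2 * (eps + 7 * l * eps + 2 * l^-1).
Proof.
move=> t0 t2 l0 e1 mw mz wz.
have dw := approx_mid_dist _ _ _ _ _ t0 t2 mw; have dz := approx_mid_dist _ _ _ _ _ t0 t2 mz.
case: mw mz => [_ _ _ [ww _ _]] [xx yy xy _].
set A := t *: (u + v) in dw; set B := t *: (x + y) in dz.
have AB : dotv A B = 2^-1 * dotv (u + v) (x + y).
  by rewrite dotvZl dotvZr mulrA -expr2 t2 mul1r.
have BB : dotv B B <= 2.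
  rewrite dotvZl dotvZr mulrA -expr2 t2 !dotvE (dotvC y x).
  by move: xx yy xy; rewrite !ler_norml => /andP[? ?] /andP[? ?] /andP[? ?]; lra.
have W2 : dotv w w <= 2 by move: ww; rewrite ler_norml => /andP[? ?]; lra.
clearbody A B.
have : dotv A B = dotv w z - dotv (w - A) B - dotv (z - B) w.
  by rewrite !dotvE (dotvC z w) (dotvC B w); ring.
rewrite {}AB.
have := dotv_amgm l (w - A) B l0; have := dotv_amgm l (z - B) w l0.
have li : 0 <= l^-1 by rewrite invr_ge0 ltW.
have := ler_wpM2l (ltW l0) dw; have := ler_wpM2l (ltW l0) dz.
have := ler_wpM2l li BB; have := ler_wpM2l li W2.
move: wz; rewrite !ler_norml => /andP[? ?] ? ? ? ? /andP[? ?] /andP[? ?] ?.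
by apply/andP; split; lra.
Qed.

(* Otherwise the vectors [e i] and [f j] would have a diagonally dominant Gram
   matrix. *)
Lemma exists_large_pairing (I : finType) (p : I -> I) (e f : I -> 'rV[R]_r) (eps : R) :
  involutive p -> (r < #|I| + #|I|)%N -> 0 <= eps ->
  (forall i j, `|dotv (e i) (e j) - (i == j)%:R| <= eps) ->
  (forall i j, `|dotv (f i) (f j) - (i == j)%:R| <= eps) ->
  (forall i j, j != p i -> `|dotv (e i) (f j)| <= eps) ->
  exists i, 1 - (2 * #|I|%:R + 1) * eps <= `|dotv (e i) (f (p i))|.
Proof.
move=> pK ltr eps0 ee ff ef.
apply/existsP; apply: contraLR ltr => /existsPn small; rewrite -leqNgt -card_sum.
pose z (s : I + I) := match s with inl i => e i | inr i => f i end.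
(* [p2 s] is the only index other than [s] whose vector may have a large inner product with
   [z s]. *)
pose p2 (s : I + I) := match s with inl i => inr (p i) | inr i => inl (p i) end.
have zz s : 1 - eps <= dotv (z s) (z s).
  by case: s => i; [have := ee i i | have := ff i i]; rewrite eqxx /= ler_norml => /andP[? ?]; lra.
have offdiag s s' : s' != s -> s' != p2 s -> `|dotv (z s') (z s)| <= eps.
  case: s s' => [] i [] j //= ne np.
  - have := ee j i; case: eqVneq => [ji|_]; last by rewrite subr0.
    by rewrite ji eqxx in ne.
  - by rewrite dotvC ef.
  - by apply: ef; apply: contraNneq np => ->; rewrite pK.
  - have := ff j i; case: eqVneq => [ji|_]; last by rewrite subr0.
    by rewrite ji eqxx in ne.
have pair s : `|dotv (z (p2 s)) (z s)| < 1 - (2 * #|I|%:R + 1) * eps.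
  case: s => i /=; first by rewrite dotvC ltNge small.
  by have := small (p i); rewrite pK -ltNge.
apply: (card_diag_dominant _ z) => s.
apply: lt_le_trans (zz s).
have p2s : p2 s != s by case: (s).
rewrite (bigD1 (p2 s)) //=.
(* Counting all [2 * #|I|] indices here, plus the [eps] lost on the diagonal entry, gives the factor
   [2 * #|I| + 1]. *)
have : \sum_(j | (j != s) && (j != p2 s)) `|dotv (z j) (z s)| <= \sum_(j : I + I) eps.
  rewrite [leRHS](bigID (fun j => (j != s) && (j != p2 s))) /=.
  apply: ler_wpDr; first exact: sumr_ge0.
  by apply: ler_sum => j /andP[]; exact: offdiag.
rewrite sumr_const card_sum -(mulr_natl eps) natrD => ?.
by have := pair s; lra.
Qed.

(** There are [2 k] indices, so [exists_large_pairing] loses [(4 k + 1) eps]. One [d] is spent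
    moving the large pairing to an odd index, where the boolean is [true], and another [d] carrying
    it from [g0] to every [g]. *)
Lemma variable_estimate (k : nat) (e f : 'I_k * bool -> 'rV[R]_r) (eps d : R) :
  (r < 4 * k)%N -> 0 <= eps -> (4 * k%:R + 1) * eps + 2 * d < 1 ->
  (forall i j, `|dotv (e i) (e j) - (i == j)%:R| <= eps) ->
  (forall i j, `|dotv (f i) (f j) - (i == j)%:R| <= eps) ->
  (forall i j, j != (i.1, ~~ i.2) -> `|dotv (e i) (f j)| <= eps) ->
  (forall g, `|dotv (e (g, true)) (f (g, false)) + dotv (e (g, false)) (f (g, true))| <= d) ->
  (forall g g' : 'I_k, (g < g')%N ->
     `|dotv (e (g, true)) (f (g, false)) - dotv (e (g', true)) (f (g', false))| <= d) ->
  exists b : bool, forall g,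
    1 - ((4 * k%:R + 1) * eps + 2 * d)
      <= (sgn_of b)%:~R * dotv (e (g, true)) (f (g, false)).
Proof.
move=> hr eps0 small ee ff ef sum0 diff0.
pose p (i : 'I_k * bool) := (i.1, ~~ i.2).
have pK : involutive p by case=> g b; rewrite /p /= negbK.
have [|[g0 b0]] := exists_large_pairing _ p e f eps pK _ eps0 ee ff ef.
  by rewrite card_prod card_ord card_bool; lia.
rewrite card_prod card_ord card_bool natrM /= => big.
set a := fun g => dotv (e (g, true)) (f (g, false)).
have d0 : 0 <= d by apply: le_trans (sum0 g0).
have big0 : 1 - ((4 * k%:R + 1) * eps + d) <= `|a g0|.
  move: big (sum0 g0); rewrite -/(a g0); case: b0 => /=; rewrite -?/(a g0).
    by move=> ? _; lra.
  set x := dotv _ _; rewrite ler_norml => + /andP[].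
  by case: (ger0P x); case: (ger0P (a g0)); lra.
have near g : `|a g - a g0| <= d.
  have [lt|gt|/val_inj ->] := ltngtP g g0; last by rewrite subrr normr0.
    exact: diff0.
  by rewrite distrC; exact: diff0.
exists (0 < a g0) => g; rewrite -/(a g); have := near g; rewrite ler_norml => /andP[? ?].
case: ltP => ag; rewrite /sgn_of ?mul1r ?rmorphN1 ?mulN1r.
  by rewrite gtr0_norm // in big0; lra.
by rewrite ler0_norm // in big0; lra.
Qed.

End SignExtraction.

(** * From the sign of each variable to the inner product of the clause vectors *)

Section Clause.
Context {R : realFieldType} {r k : nat}.
Implicit Types (e h v x : 'I_k -> 'rV[R]_r) (t : 'I_k -> R) (c : 'rV[R]_r).

Lemma dotv_sum_close x (u w : 'I_k -> R) c (eps : R) :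
  (forall g, `|u g| <= 1) -> (forall g, `|dotv c (x g) - w g| <= eps) ->
  `|dotv c (\sum_g u g *: x g) - \sum_g u g * w g| <= k%:R * eps.
Proof.
move=> hu hc; rewrite dotv_sumr.
have -> : k%:R * eps = \sum_(g < k) eps by rewrite sumr_const card_ord mulr_natl.
rewrite -sumrB; apply: le_trans (ler_norm_sum _ _ _) _; apply: ler_sum => g _.
rewrite dotvZr -mulrBr normrM -[leRHS]mul1r; apply: ler_pM => //.
Qed.

(* Bounding each term [c . (v g - e g)] by Cauchy-Schwarz would lose a factor
   that is too large when [k] grows.  The vectors [h g := v g - e g] are however
   almost orthogonal to all [e g'] and [c] is close to the span of the [e g'],
   so that [c . h g] is of second order. *)
Lemma clause_estimate (e v : 'I_k -> 'rV[R]_r) (t : 'I_k -> R) (c c0 : 'rV[R]_r)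
    (s q eps de : R) :
  (3 <= k)%N -> 0 < s -> s ^+ 2 = q -> k%:R * q = 1 ->
  0 <= eps -> k%:R ^+ 3 * eps <= 10%:R ^- 6 * q ^+ 2 ->
  0 <= de -> de <= 21 / 1000 * q ^+ 2 ->
  (forall g, `|t g| = 1) ->
  (forall g g', `|dotv (e g) (e g') - (g == g')%:R| <= eps) ->
  (forall g, `|dotv (v g) (v g) - 1| <= eps) ->
  (forall g, 1 - de <= dotv (e g) (v g)) ->
  (forall g g', g != g' -> `|dotv (e g) (v g')| <= eps) ->
  `|dotv c c - 1| <= eps -> `|dotv c0 c0 - 1| <= eps ->
  (forall g, `|dotv c (v g) - t g * s| <= eps) ->
  (forall g, `|dotv c0 (e g) - s| <= eps) ->
  `|dotv c0 c - q * \sum_g t g| <= q.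
Proof.
move=> k3 s0 sq kq eps0 heps de0 hde ht hee hvv hev hev' hc hc0 hcv hce.
set K : R := k%:R in kq heps *.
have K3 : 3 <= K by rewrite ler_nat.
have q0 : 0 < q by rewrite -sq exprn_gt0.
have q3 : 3 * q <= 1 by have := ler_wpM2r (ltW q0) K3; rewrite kq.
pose h g := v g - e g.
(* [E one] will approximate [c0] and [E t + H t] will approximate [c]. Since [E u + H u] is the
   combination of the [v g], its product with [c] is known from the constraints, and only
   [c . H one] remains to be bounded. *)
pose E u := s *: \sum_g u g *: e g.
pose H u := s *: \sum_g u g *: h g.
pose one (g : 'I_k) : R := 1.
have hone g : `|one g| = 1 by rewrite normr1.
have hone_le g : `|one g| <= 1 by rewrite normr1.
have ht_le g : `|t g| <= 1 by rewrite ht.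
have hh g : dotv (h g) (h g) <= 2 * de + 2 * eps.
  have := hee g g; have := hvv g; have := hev g.
  rewrite eqxx /h !dotvE (dotvC (v g) (e g)) !ler_norml => a /andP[b b'] /andP[d d'].
  by rewrite /= in d d'; clear -a b b' d d'; lra.
(* The squared norm of [h g] is only of order [de], yet so is [e g . h g] itself: this is the
   second-order gain. On the diagonal, the lower bound comes from [hev] and the upper bound from
   AM-GM on [e g . v g]. *)
have heh g g' : `|dotv (e g) (h g')| <= de *+ (g == g') + 2 * eps.
  have := hee g g'; rewrite /h !dotvE; case: eqVneq => [<-|gg'] /=; last first.
    have := hev' g g' gg'; rewrite !ler_norml mulr0n subr0.
    by clear => /andP[? ?] /andP[? ?]; apply/andP; split; lra.
  have := dotv_amgm 1 (e g) (v g) ltr01; rewrite invr1 !mul1r.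
  have := hee g g; have := hvv g; have := hev g; rewrite eqxx mulr1n !ler_norml.
  move: eps0 de0; clear=> ? ? ? /andP[? ?] /andP[? ?] /andP[? ?] /andP[? ?].
  by apply/andP; split; lra.
(* Scaling by [s ^+ 2 = 1 / k] averages the [k] diagonal errors, so [de] appears without a factor
   [K]. *)
have sHH u w : (forall g, `|u g| <= 1) -> (forall g, `|w g| <= 1) ->
    `|dotv (E u) (H w)| <= de + 2 * (K * eps).
  move=> hu hw; rewrite dotvZl dotvZr mulrA -expr2 sq normrM gtr0_norm //.
  have := dotv_sum_le k e h u w de (2 * eps) hu hw heh.
  rewrite -(ler_pM2l q0) -/K => /le_trans; apply.
  have -> : q * (K * de + K ^+ 2 * (2 * eps)) = (K * q) * (de + 2 * (K * eps)) by ring.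
  by rewrite kq; lra.
have sE u : (forall g, `|u g| <= 1) -> dotv (E u) (E u) <= 1 + K * eps.
  move=> hu; rewrite dotvZl dotvZr mulrA -expr2 sq.
  have hee' g g' : `|dotv (e g) (e g')| <= 1 *+ (g == g') + eps.
    have := hee g g'; rewrite !ler_norml.
    move: eps0; clear.
    by case: (g == g') => /= ? /andP[? ?]; apply/andP; split; rewrite ?mulr1n ?mulr0n; lra.
  have /(le_trans (ler_norm _)) := dotv_sum_le k e e u u 1 eps hu hu hee'.
  rewrite -(ler_pM2l q0) -/K => /le_trans; apply.
  have -> : q * (K * 1 + K ^+ 2 * eps) = (K * q) * (1 + K * eps) by ring.
  by rewrite kq; lra.
have sH u : (forall g, `|u g| = 1) -> dotv (H u) (H u) <= K * (2 * de + 2 * eps).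
  move=> hu; rewrite dotvZl dotvZr mulrA -expr2 sq.
  have := dotv_sum_sqr_le _ (fun g => u g *: h g); rewrite card_ord -/K.
  rewrite -(ler_pM2l q0) mulrA (mulrC q K) kq mul1r => /le_trans; apply.
  have -> : K * (2 * de + 2 * eps) = \sum_(g < k) (2 * de + 2 * eps).
    by rewrite sumr_const card_ord -(mulr_natl (2 * de + 2 * eps)).
  apply: ler_sum => g _; rewrite dotvZl dotvZr mulrA -expr2 -real_normK ?num_real //.
  by rewrite hu expr1n mul1r.
have EH u : E u + H u = s *: \sum_g u g *: v g.
  rewrite -scalerDr -big_split /=; congr (_ *: _); apply: eq_bigr => g _.
  by rewrite -scalerDr /h addrC subrK.
have s1 : s <= 1.
  by rewrite -(ler_pXn2r (n := 2)) ?nnegrE ?ltW // expr1n sq; clear -q0 q3; lra.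
have tt g : t g * t g = 1 by rewrite -expr2 -real_normK ?num_real // ht expr1n.
have Keps0 : 0 <= K * eps by rewrite mulr_ge0 // ler0n.
have sKe : s * (K * eps) <= K * eps by rewrite ler_piMl.
have cEt : 1 - K * eps <= dotv c (E t + H t).
  have := dotv_sum_close v t (fun g => t g * s) c eps ht_le hcv.
  rewrite EH dotvZr (eq_bigr (fun=> s)) => [|g _]; last by rewrite mulrA tt mul1r.
  rewrite sumr_const card_ord -(mulr_natl s) -/K ler_norml => /andP[+ _].
  rewrite -(ler_pM2l s0) mulrBr (_ : s * (K * s) = K * q); last by rewrite -sq; ring.
  by rewrite kq; clear -sKe; lra.
have cE1 : `|dotv c (E one + H one) - q * \sum_g t g| <= K * eps.
  have := dotv_sum_close v one (fun g => t g * s) c eps hone_le hcv.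
  rewrite EH dotvZr (eq_bigr (fun g => t g * s)) => [|g _]; last by rewrite mul1r.
  rewrite -mulr_suml -/K -sq -(ler_pM2l s0) -[X in X * `|_|]gtr0_norm // -normrM.
  rewrite mulrBr (_ : s * (_ * s) = s ^+ 2 * \sum_g t g) => [/le_trans|]; first exact.
  by ring.
have c0E : 1 - K * eps <= dotv c0 (E one).
  have := dotv_sum_close e one (fun=> s) c0 eps hone_le hce.
  rewrite dotvZr (eq_bigr (fun=> s)) => [|g _]; last by rewrite mul1r.
  rewrite sumr_const card_ord -(mulr_natl s) -/K ler_norml => /andP[+ _].
  rewrite -(ler_pM2l s0) mulrBr (_ : s * (K * s) = K * q); last by rewrite -sq; ring.
  by rewrite kq; clear -sKe; lra.
clearbody E H.
pose D := c - (E t + H t).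
(* Both [c] and [E t + H t] have squared norm close to 1, and by [cEt] their inner product is close
   to 1, so their difference is small. *)
have DD : dotv D D <= 2 * de + (7 * K + 1) * eps + K * (2 * de + 2 * eps).
  have := sHH t t ht_le ht_le; have := sE t ht_le; have := sH t ht.
  move: cEt hc; rewrite /D !dotvE (dotvC (E t) c) (dotvC (H t) c) (dotvC (H t) (E t)) !ler_norml.
  by clear => ? /andP[? ?] ? ? /andP[? ?]; lra.
have cH : `|dotv c (H one)| <= 2 * de + 2 * K * (2 * de + 2 * eps) + 6 * K * eps + eps.
  have -> : dotv c (H one) = dotv D (H one) + dotv (E t) (H one) + dotv (H t) (H one).
    by rewrite /D !dotvE; ring.
  have := dotv_amgm 1 D (H one) ltr01; have := dotv_amgm 1 (H t) (H one) ltr01.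
  rewrite invr1 !mul1r; have := sHH t one ht_le hone_le; have := sH t ht; have := sH one hone.
  move: DD Keps0 eps0; rewrite !ler_norml; clear=> ? ? ? ? ? /andP[? ?] /andP[? ?] /andP[? ?].
  by apply/andP; split; lra.
have F : dotv (c0 - E one) (c0 - E one) <= eps + 3 * (K * eps).
  have := sE one hone_le; move: c0E hc0; rewrite !dotvE (dotvC (E one) c0) ler_norml.
  by clear => ? /andP[? ?] ?; lra.
have K_gt0 : 0 < K by apply: lt_le_trans K3.
have l0 : 0 < 10 * K by rewrite mulr_gt0.
(* With weight [10 K], the term in [c] costs about [q / 20], while the other costs [5 K] times the
   bound [F], which is of order [K ^+ 2 * eps] and far below [q]. *)
have := dotv_amgm (10 * K) (c0 - E one) c l0.
have K0 : K != 0 by rewrite gt_eqF.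
have Kq : K^-1 = q by apply: (mulfI K0); rewrite kq divff.
rewrite invfM Kq.
have K_ge0 := ltW K_gt0.
have KF := ler_wpM2l K_ge0 F.
have qq : K * q ^+ 2 = q by rewrite expr2 mulrA kq mul1r.
have q2 : 3 * q ^+ 2 <= q.
  by have := ler_wpM2r (exprn_ge0 2 (ltW q0)) K3; rewrite qq.
have Kde : K * de <= 21 / 1000 * q.
  by have := ler_wpM2l K_ge0 hde; rewrite mulrCA qq.
have e1 : 3 * eps <= K * eps by rewrite ler_wpM2r.
have e2 : 3 * (K * eps) <= K ^+ 2 * eps by rewrite expr2 -mulrA ler_wpM2r.
have e3 : 3 * (K ^+ 2 * eps) <= K ^+ 3 * eps.
  by rewrite (exprS K 2) -mulrA ler_wpM2r // mulr_ge0 // exprn_ge0.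
have cq : q * dotv c c <= q * (1 + eps).
  by apply: (ler_wpM2l (ltW q0)); move: hc; rewrite ler_norml; clear=> /andP[? ?]; lra.
have qe : q * eps <= eps by apply: ler_piMl => //; clear -q0 q3; lra.
have h10 : 10%:R ^- 6 <= 1 / 1000 :> R by clear -q0; lra.
have heps' : K ^+ 3 * eps <= q / 1000.
  have := ler_wpM2r (exprn_ge0 2 (ltW q0)) h10.
  by move=> hq; clear -hq heps q2; lra.
have -> : dotv c0 c = dotv (c0 - E one) c + dotv c (E one + H one) - dotv c (H one).
  by rewrite !dotvE (dotvC (E one) c); ring.
move: KF q2 Kde e1 e2 e3 cq qe heps' eps0 q0 hde cE1 cH; rewrite !ler_norml; clear.
move=> ? ? ? ? ? ? ? ? ? ? ? ? /andP[? ?] /andP[? ?] /andP[? ?].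
by apply/andP; split; lra.
Qed.
End Clause.

(** * The index pairing [pp] and arithmetic of signs *)

Lemma pp_range k i : (1 <= i <= 2 * k)%N -> (1 <= pp i <= 2 * k)%N.
Proof. rewrite /pp; case: ifP; lia. Qed.

Lemma ppK i : (1 <= i)%N -> pp (pp i) = i.
Proof. by case: i => // i _; rewrite /pp /=; case oi: (odd i) => /=; rewrite oi. Qed.

Lemma odd_pp i : (1 <= i)%N -> odd (pp i) = ~~ odd i.
Proof. by case: i => // i _; rewrite /pp /=; case oi: (odd i) => /=; rewrite oi. Qed.

Lemma sum_signs (R : comPzRingType) (k : nat) (a : 'I_k -> int) :
  (forall g, a g = 1 \/ a g = -1) ->
  \sum_g (a g)%:~R = k%:R - 2 * #|[set g | a g == -1]|%:R :> R.
Proof.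
move=> ha; rewrite -sum1_card natr_sum mulr_sumr.
rewrite (eq_bigr (fun g => 1 - (if a g == -1 then 2 else 0))); last first.
  by move=> g _; case: (ha g) => ->; rewrite ?eqxx ?mulr1z ?rmorphN1 /=; ring.
rewrite sumrB sumr_const card_ord -big_mkcond /=; congr (_ - _).
by apply: eq_big => [g|g _]; rewrite ?inE ?mulr1.
Qed.

Lemma sgn_of_mul_cases a b : sgn_of a * sgn_of b = 1 \/ sgn_of a * sgn_of b = -1.
Proof. by case: a; case: b; [left|right|right|left]. Qed.

Lemma sgn_of_sqr (R : pzRingType) b : (sgn_of b)%:~R * (sgn_of b)%:~R = 1 :> R.
Proof. by case: b; rewrite /sgn_of ?mulr1 ?rmorphN1 ?mulrNN ?mulr1. Qed.

Lemma inv_sqrt_sqr (R : rcfType) (n : nat) : (0 < n)%N ->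
  (1 / Num.sqrt n%:R) ^+ 2 = 1 / n%:R :> R.
Proof. by move=> n0; rewrite exprMn expr1n exprVn sqr_sqrtr ?ler0n. Qed.

(** * The exact family of vectors built from a satisfying assignment *)

Section Exact.
Context {R : rcfType} {k : nat}.

(* Indexed from 1, like the families in the constraint system. *)
Definition unitv (i : nat) : 'rV[R]_(2 * k) := \row_j ((j : nat) == i.-1)%:R.

Lemma dotv_unitv i j : (1 <= i <= 2 * k)%N -> (1 <= j <= 2 * k)%N ->
  dotv (unitv i) (unitv j) = (i == j)%:R.
Proof.
move=> hi hj; have i1 : (i.-1 < 2 * k)%N by lia.
rewrite /dotv (bigD1 (Ordinal i1)) //= !mxE eqxx mul1r big1 ?addr0.
  by rewrite /= (_ : (i.-1 == j.-1) = (i == j)) //; apply/eqP/eqP; lia.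
move=> l nl; rewrite !mxE; case: eqP => [li|_]; last by rewrite mul0r.
by case/eqP: nl; apply: val_inj.
Qed.

Context (sig : nat -> R) (sigK : forall x, sig x * sig x = 1).

(** The variable [x.+1] has sign [sig x]. Swapping indices by [pp] leaves only the products with
    [u_(x0,pp i)] nonzero; negating at odd [i] makes them [sig x] at odd reference indices and
    [- sig x] at even ones, so that the pair constraints cancel. *)
Definition exactU (x i : nat) : 'rV[R]_(2 * k) :=
  if x is y.+1 then (if odd i then - sig y else sig y) *: unitv (pp i) else unitv i.

Definition exactW (t : R) (x i j : nat) (s : bool) : 'rV[R]_(2 * k) :=
  t *: (exactU x i + (if s then 1 else -1) *: exactU x j).

Lemma exactW_dot t x y i j i' j' b b' :
  dotv (exactW t x i j b) (exactW t y i' j' b') = t ^+ 2 *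
    (dotv (exactU x i) (exactU y i')
     + (if b' then 1 else -1) * dotv (exactU x i) (exactU y j')
     + (if b then 1 else -1) * dotv (exactU x j) (exactU y i')
     + (if b then 1 else -1) * (if b' then 1 else -1) * dotv (exactU x j) (exactU y j')).
Proof.
rewrite /exactW; move: (exactU x i) (exactU x j) (exactU y i') (exactU y j') => u v w z.
by rewrite !dotvE; case: b; case: b'; ring.
Qed.

Lemma exactU_dot x i j : (1 <= i <= 2 * k)%N -> (1 <= j <= 2 * k)%N ->
  dotv (exactU x i) (exactU x j) = (i == j)%:R.
Proof.
move=> hi hj; case: x => [|x] /=; first exact: dotv_unitv.
rewrite dotvZl dotvZr dotv_unitv ?pp_range // mulrA.
have -> : (pp i == pp j) = (i == j).
  by apply/eqP/eqP => [/(congr1 pp)|-> //]; rewrite !ppK //; lia.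
have [->|_] := eqVneq i j; last by rewrite mulr0.
by case: ifP; rewrite ?mulrNN sigK mulr1.
Qed.

Lemma exactU_dot0 x i j : (1 <= i <= 2 * k)%N -> (1 <= j <= 2 * k)%N ->
  dotv (exactU 0 i) (exactU x.+1 j) = (if odd j then - sig x else sig x) * (i == pp j)%:R.
Proof. by move=> hi hj; rewrite /= dotvZr dotv_unitv ?pp_range. Qed.

(** As [g] starts from 0, [2 * g + 1] is the odd index of position [g.+1]. It is also
    [pp (2 * g.+1)], so reference and ordinary clause vectors live in the same [k]-dimensional
    span. *)
Definition exactV (s : R) (a : 'I_k -> R) : 'rV[R]_(2 * k) :=
  s *: \sum_g a g *: unitv (2 * g + 1).

Lemma exactV_dot s a b : dotv (exactV s a) (exactV s b) = s ^+ 2 * \sum_g a g * b g.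
Proof.
rewrite /exactV dotvZl dotvZr mulrA -expr2 dotv_suml; congr (_ * _).
apply: eq_bigr => g _; rewrite dotv_sumr (bigD1 g) //= big1 => [|h hg].
  by rewrite addr0 dotvZl dotvZr dotv_unitv ?eqxx ?mulr1 //; have := ltn_ord g; lia.
rewrite dotvZl dotvZr dotv_unitv; [|have := ltn_ord g; lia|have := ltn_ord h; lia].
case: eqP => [e|_]; last by rewrite !mulr0.
by case/eqP: hg; apply: val_inj => /=; lia.
Qed.

Lemma exactV_unitv s a (g : 'I_k) : dotv (exactV s a) (unitv (2 * g + 1)) = s * a g.
Proof.
rewrite /exactV dotvZl dotv_suml (bigD1 g) //= big1 => [|h hg].
  by rewrite addr0 dotvZl dotv_unitv ?eqxx ?mulr1 //; have := ltn_ord g; lia.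
rewrite dotvZl dotv_unitv; [|have := ltn_ord h; lia|have := ltn_ord g; lia].
case: eqP => [e|_]; last by rewrite !mulr0.
by case/eqP: hg; apply: val_inj => /=; lia.
Qed.
End Exact.

Lemma satisfiable_exact_family (R : rcfType) (n m k : nat) (hk : (0 < k)%N)
    (vars : 'I_m -> 'I_k -> 'I_n) (sg : 'I_m -> 'I_k -> bool) :
  satisfiable vars sg ->
  exists (U : nat -> nat -> 'rV[R]_(2 * k))
         (W : nat -> nat -> nat -> bool -> 'rV[R]_(2 * k))
         (V : nat -> 'rV[R]_(2 * k)),
    constraints vars sg (@eq R) U W V.
Proof.
case=> f sat.
(* The default 1 outside the range of variables keeps [sig x * sig x = 1] valid for every [x]. *)
pose sig x : R := oapp (fun j : 'I_n => (sgn_of (f j))%:~R) 1 (insub x).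
have sigK x : sig x * sig x = 1.
  by rewrite /sig; case: insub => [j|] /=; rewrite ?sgn_of_sqr ?mulr1.
have sigE (j : 'I_n) : sig j = (sgn_of (f j))%:~R by rewrite /sig valK.
(* The reference clause has all coefficients 1; clause [c] has the signed values of its literals. *)
pose a (c : nat) (g : 'I_k) : R := if c is c'.+1 then
  oapp (fun c : 'I_m => (sgn_of (sg c g) * sgn_of (f (vars c g)))%:~R) 1 (insub c') else 1.
have aE (c : 'I_m) g : a c.+1 g = (sgn_of (sg c g) * sgn_of (f (vars c g)))%:~R.
  by rewrite /a valK.
have aK c g : a c g * a c g = 1.
  case: c => [|c] /=; first by rewrite mulr1.
  case: insub => [c'|] /=; last by rewrite mulr1.
  by rewrite rmorphM mulrACA !sgn_of_sqr mulr1.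
pose t : R := 1 / Num.sqrt 2; pose s : R := 1 / Num.sqrt k%:R.
have t2 : t ^+ 2 = 1 / 2 by rewrite inv_sqrt_sqr.
have s2 : s ^+ 2 = 1 / k%:R by rewrite inv_sqrt_sqr.
have k0 : k%:R != 0 :> R by rewrite pnatr_eq0 -lt0n.
pose U := @exactU R k sig.
have UU x i j := @exactU_dot R k sig sigK x i j.
have U0U x i j := @exactU_dot0 R k sig x i j.
exists U, (exactW sig t), (fun c => exactV s (a c)).
have one_or b : (if b then 1 else -1) * (if b then 1 else -1) = 1 :> R.
  by case: b; rewrite ?mulrNN mulr1.
split; first (move=> x _; split; [|split; [|split]]).
- by move=> i hi; rewrite UU ?eqxx.
- move=> i j b i1 ij j2; have nij : (i == j) = false by lia.
  rewrite exactW_dot !UU ?eqxx ?(eq_sym j) ?nij; try lia.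
  have := one_or b; set y := (if b then _ else _) => yy.
  by rewrite t2 yy /=; field.
- by move=> i j hi hj; rewrite UU //; case: eqP.
- move=> i j i1 ij j2; have nij : (i == j) = false by lia.
  by split; rewrite /exactW !dotvE !UU ?eqxx ?(eq_sym j) ?nij; try lia; rewrite -/t /=; ring.
split; first (case=> [|x] // hx; split; [|split]).
- move=> i j hi hj nji; rewrite /U U0U // (_ : (i == pp j) = false) ?mulr0 //.
  by apply: contra_neqF nji => /eqP ->; rewrite ppK //; lia.
- move=> i hi oi.
  have pi := pp_range _ _ hi; have ppi : pp (pp i) = i by apply: ppK; lia.
  have np : (i == pp i) = false by rewrite /pp oi; lia.
  have np' : (pp i == i) = false by rewrite eq_sym.
  rewrite exactW_dot !U0U // ppi odd_pp ?oi /=; last by lia.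
  by rewrite !eqxx np np' /=; ring.
- move=> i j i1 ij j2 oi oj.
  have hi : (1 <= i <= 2 * k)%N by lia.
  have hj : (1 <= j <= 2 * k)%N by lia.
  have nij : (i == j) = false by lia.
  rewrite exactW_dot !U0U ?pp_range // !ppK ?odd_pp ?oi ?oj /= ?eqxx ?(eq_sym j) ?nij; try lia.
  by ring.
have sumK c : s ^+ 2 * (\sum_g a c g * a c g) = 1.
  rewrite (eq_bigr (fun=> 1)) => [|g _]; last exact: aK.
  by rewrite sumr_const card_ord s2; field.
split; first by rewrite exactV_dot sumK.
split.
  move=> g /andP[g1 gk]; have g1k : (g.-1 < k)%N by lia.
  have -> : (2 * g - 1)%N = (2 * (Ordinal g1k) + 1)%N by rewrite /=; lia.
  by rewrite exactV_unitv mulr1.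
split=> c; last first.
  (* Exactly one literal value is -1, so the values sum to [k - 2]; dividing by [k] gives the
     external clause constraint. *)
  rewrite exactV_dot (eq_bigr (a c.+1)) => [|g _]; last by rewrite mul1r.
  under eq_bigr do rewrite aE.
  rewrite sum_signs => [|g]; last exact: sgn_of_mul_cases.
  by have /eqP -> := sat c; rewrite s2; field.
split; first by rewrite exactV_dot sumK.
move=> g; have oE : odd (2 * g.+1) = false by rewrite oddM.
have pE : pp (2 * g.+1) = (2 * g + 1)%N by rewrite /pp oE; lia.
rewrite /U /exactU oE pE dotvZr exactV_unitv aE sigE intrM.
have := sgn_of_sqr R (f (vars c g)); set y := (sgn_of (f _))%:~R => yy.
by transitivity (s * (sgn_of (sg c g))%:~R * (y * y)); [ring | rewrite yy mulr1 /s mulrC mul1r].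
Qed.

(** * Numerical consequences of the bound on [eps], and final counting *)

Lemma eps_scale (R : realFieldType) (k : nat) (eps : R) : (3 <= k)%N ->
  0 <= eps -> eps < 10%:R ^- 6 * k%:R ^- 5 ->
  let q := k%:R^-1 in
  [/\ k%:R ^+ 3 * eps <= 10%:R ^- 6 * q ^+ 2,
      2 * (eps + 7 * (1000 * k%:R ^+ 2) * eps + 2 * (1000 * k%:R ^+ 2)^-1) + 2 * eps
        <= q ^+ 2 / 100,
      (4 * k%:R + 1) * eps + 2 * (q ^+ 2 / 100) <= 21 / 1000 * q ^+ 2,
      eps <= 1 / 4 * q & (4 * k%:R + 1) * eps + 2 * (q ^+ 2 / 100) < 1].
Proof.
move=> k3 eps0 heps /=; set K : R := k%:R in heps *.
have K3 : 3 <= K by rewrite ler_nat.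
have K_gt0 : 0 < K by apply: lt_le_trans K3.
have K_ge0 := ltW K_gt0.
have K0 : K != 0 by rewrite gt_eqF.
set q := K^-1.
have q0 : 0 < q by rewrite invr_gt0.
have q1 : 3 * q <= 1 by have := ler_wpM2r (ltW q0) K3; rewrite divff.
have e3 : K ^+ 3 * eps <= 10%:R ^- 6 * q ^+ 2.
  have -> : 10%:R ^- 6 * q ^+ 2 = K ^+ 3 * (10%:R ^- 6 * K ^- 5).
    rewrite (mulrCA (K ^+ 3)) exprVn; congr (_ * _).
    by rewrite (exprD K 3 2) (invfM (K ^+ 3)) mulrA divff ?mul1r // expf_neq0.
  by rewrite ler_wpM2l ?ltW // exprn_gt0.
(* From [3 <= K], each lower power of [K] gains a factor 3, so [e3] controls all error terms by
   linear arithmetic. *)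
have e1 : 3 * eps <= K * eps by rewrite ler_wpM2r.
have e2 : 3 * (K * eps) <= K ^+ 2 * eps.
  by rewrite expr2 -mulrA ler_wpM2r // mulr_ge0.
have e3' : 3 * (K ^+ 2 * eps) <= K ^+ 3 * eps.
  by rewrite (exprS K 2) -mulrA ler_wpM2r // mulr_ge0 // exprn_ge0.
have q2 : 0 <= q ^+ 2 by rewrite exprn_ge0 // ltW.
have qq : 3 * q ^+ 2 <= q by have := ler_wpM2r (ltW q0) q1; rewrite -mulrA mul1r.
have h10 : 10%:R ^- 6 <= 1 / 1000 / 1000 :> R by clear -q0; lra.
have hq := ler_wpM2r q2 h10.
(* The AM-GM weight [l = 1000 K ^+ 2] balances [14 l eps] against [4 / l]: each stays below
   [q ^+ 2 / 200]. *)
have -> : (1000 * K ^+ 2)^-1 = q ^+ 2 / 1000 by rewrite /q; field.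
clearbody q.
by split=> //; clear -eps0 e1 e2 e3 e3' hq q1 qq q0; lra.
Qed.

Lemma norm_middle_le (R : realFieldType) (x y z w b eps d : R) :
  `|x| <= eps -> `|w| <= eps -> b + 2 * eps <= d -> `|x + y + (z + w)| <= b ->
  `|y + z| <= d.
Proof.
rewrite !ler_norml => /andP[? ?] /andP[? ?] ? /andP[? ?].
by apply/andP; split; lra.
Qed.

(** The candidates [1 - 2 q N] are spaced [2 q] apart, while the two tolerances add up to at most
    [5 q / 4]. *)
Lemma count_eq_one (R : realFieldType) (N : nat) (x q eps : R) :
  0 < q -> eps <= 1 / 4 * q ->
  `|x - (1 - 2 * q)| <= eps -> `|x - (1 - 2 * (q * N%:R))| <= q -> N = 1%N.
Proof.
move=> q0 epsq; rewrite !ler_norml => /andP[v1 v2] /andP[v3 v4].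
have [N1|N1|//] := ltngtP N 1%N; exfalso.
  have N0 : N%:R = 0 :> R by case: (N) N1.
  by move: v3; rewrite N0 mulr0; lra.
have : q * 2 <= q * N%:R by apply: (ler_wpM2l (ltW q0)); rewrite ler_nat.
lra.
Qed.

(** * Extracting a satisfying assignment from an approximate family *)

Section Soundness.
Context {R : realType} {n m k r : nat}.
Context (vars : 'I_m -> 'I_k -> 'I_n) (sg : 'I_m -> 'I_k -> bool) (eps : R).
Context (U : nat -> nat -> 'rV[R]_r) (W : nat -> nat -> nat -> bool -> 'rV[R]_r)
  (V : nat -> 'rV[R]_r).
Context (k3 : (3 <= k)%N) (r_lt : (r < 4 * k)%N)
  (eps_lt : eps < 10%:R ^- 6 * k%:R ^- 5)
  (UWV : constraints vars sg (approx eps) U W V).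

Let K : R := k%:R.
(** The loss in [variable_estimate] when [d] is [K^-1 ^+ 2 / 100]. *)
Let de : R := (4 * K + 1) * eps + 2 * (K^-1 ^+ 2 / 100).

Lemma constraints_eps_ge0 : 0 <= eps.
Proof. by case: UWV => _ [_ [V0 _]]; apply: le_trans V0. Qed.

(* The pairs (g, true) and (g, false) with 0 <= g < k number the odd index 2g + 1
   and the even index 2g + 2. *)
Definition pos (i : 'I_k * bool) : nat := (2 * i.1 + (if i.2 then 1 else 2))%N.

Lemma pos_range i : (1 <= pos i <= 2 * k)%N.
Proof. by case: i => g b; have := ltn_ord g; rewrite /pos /=; case: b; lia. Qed.

Lemma pos_inj : injective pos.
Proof.
move=> [g b] [h c]; rewrite /pos /= => e.
have bc : b = c by case: b c e => [] []; lia.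
by rewrite bc in e *; congr (_, _); apply: val_inj => /=; move: e; case: c {bc}; lia.
Qed.

Lemma pos_odd g : pos (g, true) = (2 * g.+1 - 1)%N.
Proof. by rewrite /pos /= mulnS addnC -addnBAC. Qed.

Lemma pos_even g : pos (g, false) = (2 * g.+1)%N.
Proof. by rewrite /pos /= mulnS addnC. Qed.

Lemma pos_odd_lt_even g : (pos (g, true) < pos (g, false))%N.
Proof. by rewrite /pos /= ltn_add2l. Qed.

Lemma pos_mono (g h : 'I_k) b : (g < h)%N -> (pos (g, b) < pos (h, b))%N.
Proof. by move=> gh; rewrite /pos /= ltn_add2r ltn_pmul2l. Qed.

Lemma pp_pos i : pp (pos i) = pos (i.1, ~~ i.2).
Proof. by case: i => g [] /=; rewrite /pp /pos /= oddD oddM /=; lia. Qed.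

Lemma U_pos_gram x i j : (x <= n)%N ->
  `|dotv (U x (pos i)) (U x (pos j)) - (i == j)%:R| <= eps.
Proof.
move=> xn; case: UWV => /(_ x xn)[_ [_ [+ _]]] _.
move=> /(_ _ _ (pos_range i) (pos_range j)).
by rewrite (inj_eq pos_inj); case: eqP.
Qed.

(** A difference is treated as a midpoint with [- U x (pos j)], so that [approx_mid] serves both
    signs. *)
Lemma W_mid x i j : (x <= n)%N -> (pos i < pos j)%N ->
  approx_mid (1 / Num.sqrt 2) eps (W x (pos i) (pos j) true) (U x (pos i)) (U x (pos j)) /\
  approx_mid (1 / Num.sqrt 2) eps (W x (pos i) (pos j) false) (U x (pos i)) (- U x (pos j)).
Proof.
move=> xn ij; have ii := U_pos_gram x i i xn; have jj := U_pos_gram x j j xn.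
have := U_pos_gram x i j xn; rewrite (_ : (i == j) = false); last first.
  by apply: contraTF ij => /eqP ->; rewrite ltnn.
rewrite subr0 => uij; rewrite !eqxx in ii jj.
have /andP[i1 _] := pos_range i; have /andP[_ jk] := pos_range j.
case: UWV => /(_ x xn)[_ [WW [_ WU]]] _.
have [wi wj vi vj] := WU _ _ i1 ij jk.
by split; (split; [| | |split]); rewrite ?dotvNl ?dotvNr ?opprK ?normrN //; exact: WW.
Qed.

Lemma sign_exists (x : 'I_n) : exists b : bool, forall g,
  1 - de <= (sgn_of b)%:~R * dotv (U 0%N (pos (g, true))) (U x.+1 (pos (g, false))).
Proof.
have eps0 := constraints_eps_ge0.
have [_ bound _ eps4q small] := eps_scale _ _ _ k3 eps0 eps_lt.
have xn : (x.+1 <= n)%N by [].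
have K_gt0 : 0 < K by rewrite ltr0n; apply: leq_trans k3.
have K0 : K != 0 by rewrite gt_eqF.
have eps4 : eps <= 1 / 4.
  apply: le_trans eps4q _; rewrite ler_piMr ?divr_ge0 //.
  by rewrite invf_cp1 // ler1n; apply: leq_trans k3.
have cross i j : j != (i.1, ~~ i.2) ->
    `|dotv (U 0%N (pos i)) (U x.+1 (pos j))| <= eps.
  move=> nij; case: UWV => _ [/(_ x.+1 xn)[+ _] _].
  move=> /(_ _ _ (pos_range i) (pos_range j)); rewrite /approx subr0; apply.
  by rewrite pp_pos (inj_eq pos_inj).
have l0 : 0 < 1000 * K ^+ 2 by rewrite mulr_gt0 // exprn_gt0.
have t0 : 0 <= 1 / Num.sqrt 2 :> R by rewrite divr_ge0 // sqrtr_ge0.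
have t2 := inv_sqrt_sqr R 2 isT.
have dot4 (w u v z y1 y2 : 'rV[R]_r) := approx_mid_dot _ _ eps w u v y1 y2 z t0 t2 l0 eps4.
apply: (variable_estimate k (fun i => U 0%N (pos i)) (fun i => U x.+1 (pos i)) eps
   (K^-1 ^+ 2 / 100) r_lt eps0).
- exact: small.
- by move=> i j; exact: U_pos_gram.
- by move=> i j; exact: U_pos_gram.
- exact: cross.
(* In the product of [u_(x0,i) + u_(x0,p(i))] with [u_(x,i) + u_(x,p(i))], the equal-index terms are
   small by [cross], leaving the sum of the two pairings. *)
- move=> g; have lt12 := pos_odd_lt_even g.
  have [m0 _] := W_mid 0%N _ _ isT lt12; have [mx _] := W_mid x.+1 _ _ xn lt12.
  have wz : `|dotv (W 0%N (pos (g, true)) (pos (g, false)) true)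
                 (W x.+1 (pos (g, true)) (pos (g, false)) true)| <= eps.
    case: UWV => _ [/(_ x.+1 xn)[_ [+ _]] _].
    move=> /(_ _ (pos_range (g, true))); rewrite pp_pos /approx subr0; apply.
    by rewrite /pos /= oddD oddM.
  have := dot4 _ _ _ _ _ _ m0 mx wz; rewrite !dotvE.
  have ne b : (g, b) != (g, ~~ b) by rewrite xpair_eqE eqxx; case: b.
  have := cross (g, true) (g, true) (ne true); have := cross (g, false) (g, false) (ne false).
  by move=> sm1 sm2; apply: norm_middle_le sm2 sm1 bound.
(* The product is now of [u_(x0,i) + u_(x0,j)] with [u_(x,p(i)) - u_(x,p(j))], whose non-small terms
   are the difference of the pairings at [i] and [j]. *)
- move=> g h gh; have lt_odd := pos_mono g h true gh; have lt_even := pos_mono g h false gh.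
  have [m0 _] := W_mid 0%N _ _ isT lt_odd; have [_ mx] := W_mid x.+1 _ _ xn lt_even.
  have wz : `|dotv (W 0%N (pos (g, true)) (pos (h, true)) true)
                 (W x.+1 (pos (g, false)) (pos (h, false)) false)| <= eps.
    case: UWV => _ [/(_ x.+1 xn)[_ [_ +]] _].
    have /andP[g1 _] := pos_range (g, true); have /andP[_ h2] := pos_range (h, true).
    move=> /(_ _ _ g1 lt_odd h2); rewrite !pp_pos /approx subr0; apply.
      by rewrite /pos /= oddD oddM.
    by rewrite /pos /= oddD oddM.
  have := dot4 _ _ _ _ _ _ m0 mx wz; rewrite !dotvE.
  have ngh : (g == h) = false by apply: contraTF gh => /eqP ->; rewrite ltnn.
  have := cross (g, true) (h, false); have := cross (h, true) (g, false).
  rewrite !xpair_eqE ?(eq_sym h) ngh /= => /(_ isT) sm1 /(_ isT) sm2.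
  rewrite (addrC (dotv (U 0%N (pos (g, true))) _)) (addrC (dotv (U 0%N (pos (h, true))) _)).
  by apply: norm_middle_le bound; rewrite ?normrN.
Qed.

Lemma constraints_satisfiable : satisfiable vars sg.
Proof.
have [f hf] := fin_all_exists sign_exists.
have eps0 := constraints_eps_ge0.
have [e1 _ e3 eps4q _] := eps_scale _ _ _ k3 eps0 eps_lt; rewrite -/K in e1 e3 eps4q.
have K_gt0 : 0 < K by rewrite ltr0n; apply: leq_trans k3.
have K0 : K != 0 by rewrite gt_eqF.
have q0 : 0 < K^-1 by rewrite invr_gt0.
pose s : R := 1 / Num.sqrt K.
have s0 : 0 < s by rewrite divr_gt0 // sqrtr_gt0.
have sq : s ^+ 2 = K^-1 by rewrite inv_sqrt_sqr ?div1r //; apply: leq_trans k3.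
exists f => c; apply/eqP.
set N := #|_|.
pose t g : int := sgn_of (sg c g) * sgn_of (f (vars c g)).
have norm_sgn b : `|(sgn_of b)%:~R| = 1 :> R.
  by case: b; rewrite /sgn_of ?normr1 ?rmorphN1 ?normrN1.
case: UWV => _ [_ [V00 [V0U [VC V0V]]]].
have [VV VU] := VC c.
have K2 : 0 <= K^-1 ^+ 2 by rewrite exprn_ge0 // ltW.
(* Multiplying each variable vector by its sign brings it close to the reference vector; the sign
   then moves into the target value [t g] of the literal. *)
have /= main := clause_estimate (fun g => U 0%N (pos (g, true)))
  (fun g => (sgn_of (f (vars c g)))%:~R *: U (vars c g).+1 (pos (g, false)))
  (fun g => (t g)%:~R) (V c.+1) (V 0%N) s K^-1 eps de k3 s0 sq (divff K0) eps0 e1.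
have : `|dotv (V 0%N) (V c.+1) - K^-1 * \sum_g (t g)%:~R| <= K^-1.
  apply: main.
  - apply: addr_ge0; apply: mulr_ge0 => //; last by rewrite divr_ge0.
    by rewrite addr_ge0 // mulr_ge0 // ltW.
  - by rewrite /de; exact: e3.
  - by move=> g; rewrite intrM normrM !norm_sgn mulr1.
  - move=> g h; have := U_pos_gram 0%N (g, true) (h, true) isT.
    by rewrite xpair_eqE eqxx andbT.
  - move=> g; rewrite dotvZl dotvZr mulrA sgn_of_sqr mul1r.
    by have := U_pos_gram (vars c g).+1 (g, false) (g, false) (ltn_ord _); rewrite eqxx.
  - by move=> g; rewrite dotvZr.
  - move=> g h gh; rewrite dotvZr normrM norm_sgn mul1r.
    case: UWV => _ [/(_ (vars c h).+1 (ltn_ord _))[+ _] _].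
    move=> /(_ _ _ (pos_range (g, true)) (pos_range (h, false))); rewrite /approx subr0; apply.
    by rewrite pp_pos (inj_eq pos_inj) xpair_eqE eqxx andbT eq_sym.
  - exact: VV.
  - exact: V00.
  - move=> g; have := VU g; rewrite /approx => vu.
    have := sgn_of_sqr R (f (vars c g)); have := norm_sgn (f (vars c g)).
    rewrite pos_even dotvZr intrM; set y := (sgn_of (f _))%:~R => ny yy.
    have -> : y * dotv (V c.+1) (U (vars c g).+1 (2 * g.+1)%N) - (sgn_of (sg c g))%:~R * y * s
      = y * (dotv (V c.+1) (U (vars c g).+1 (2 * g.+1)%N) - (sgn_of (sg c g))%:~R / Num.sqrt K).
      by rewrite /s; ring.
    by rewrite normrM ny mul1r.
  - move=> g; have gk : (1 <= g.+1 <= k)%N by exact: ltn_ord.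
    by have := V0U _ gk; rewrite /approx -pos_odd.
have -> : \sum_g (t g)%:~R = K - 2 * N%:R by apply: sum_signs => g; exact: sgn_of_mul_cases.
have := V0V c; rewrite /approx -/K => v0v main'.
have qK : K^-1 * (K - 2 * N%:R) = 1 - 2 * (K^-1 * N%:R).
  by rewrite mulrBr mulVf //; ring.
by apply: (count_eq_one _ _ _ _ _ q0 eps4q v0v); rewrite -qK.
Qed.
End Soundness.

Theorem theoremC1 (R : realType) (n m k : nat) (hk : (3 <= k)%N)
    (vars : 'I_m -> 'I_k -> 'I_n) (sg : 'I_m -> 'I_k -> bool) :
  (satisfiable vars sg ->
     exists (U : nat -> nat -> 'rV[R]_(2 * k))
            (W : nat -> nat -> nat -> bool -> 'rV[R]_(2 * k))
            (V : nat -> 'rV[R]_(2 * k)),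
       constraints vars sg (@eq R) U W V)
  /\
  (forall (r : nat) (eps : R),
     (r <= 4 * k - 1)%N ->
     eps < 10%:R ^- 6 * k%:R ^- 5 ->
     (exists (U : nat -> nat -> 'rV[R]_r)
             (W : nat -> nat -> nat -> bool -> 'rV[R]_r)
             (V : nat -> 'rV[R]_r),
        constraints vars sg (approx eps) U W V) ->
     satisfiable vars sg).
Proof.
split; first by apply: satisfiable_exact_family; apply: leq_trans hk.
move=> r eps hr; have r_lt : (r < 4 * k)%N by lia.
move=> heps [U [W [V UWV]]].
exact: (constraints_satisfiable vars sg eps U W V hk r_lt heps UWV).
Qed.
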